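(* Let $n,s,t,k$ be positive integers with $k\geq \binom{s}{2}$, and let $c_1,c_2,\ldots,c_k$ be all the $k$ colors. If, for some $p_1,p_2,\ldots,p_k$ with $0\leq p_i\leq 1$ $(1\leq i\leq k)$, $$\binom{n}{s}\left[\left(\frac{s(s-1)}{2}\right)!\right]\sum_{\{x_1,x_2,\ldots,x_{\binom{s}{2}}\}\subseteq \{1,2,\ldots,k\}}p_{x_1}p_{x_2}\cdots p_{x_{\binom{s}{2}}}+\binom{n}{t}\sum_{x_i\in\{1,2,\ldots,k\}}p_{x_i}^{\binom{t}{2}}<1,$$ where the first sum runs over all subsets of $\{1,2,\ldots,k\}$ with exactly $\binom{s}{2}$ elements and the second sum runs over all elements of $\{1,2,\ldots,k\}$, then $\operatorname{gr}_k(s,t)>n$.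
   Context: A $k$-edge-coloring of $K_n$ assigns to each edge one of the $k$ colors $c_1,\ldots,c_k$ (not all colors need be used, and it need not be proper). A subgraph is rainbow if all its edges have distinct colors, and monochromatic if all its edges have the same color. The Gallai-Ramsey function $\operatorname{gr}_k(s,t)$ is the minimum integer $n$ such that every $k$-edge-coloring of the complete graph $K_n$ contains a rainbow copy of $K_s$ or a monochromatic copy of $K_t$.
   Formalization: The condition p_1+...+p_k=1 is added; without it the claim is false (s=t=k=3, all p_i=0 makes the left side 0 for every n, while gr_3(3,3) is finite). The case of sum greater than 1 follows by dividing each p_i by the sum. *)

(* Defs.v *)
From mathcomp Require Import all_boot all_order all_algebra.

Set Implicit Arguments.
Unset Strict Implicit.
Unset Printing Implicit Defensive.

(* Edges of the complete graph on the vertex type T. *)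
Definition edge (T : finType) := {e : {set T} | #|e| == 2}.

(* k-edge-colorings of K_n: arbitrary maps, neither proper nor onto. *)
Definition coloring (n k : nat) := {ffun edge 'I_n -> 'I_k}.

Section Copies.
Variables (n k : nat) (c : coloring n k).

(* A copy of K_s in K_n is determined by its vertex set A, with #|A| = s. *)
Definition rainbow (A : {set 'I_n}) : bool :=
  [forall e : edge 'I_n, forall f : edge 'I_n,
    [&& val e \subset A, val f \subset A & c e == c f] ==> (e == f)].

Definition monochromatic (A : {set 'I_n}) : bool :=
  [forall e : edge 'I_n, forall f : edge 'I_n,
    (val e \subset A) && (val f \subset A) ==> (c e == c f)].

Definition has_rainbow (s : nat) : bool :=
  [exists A : {set 'I_n}, (#|A| == s) && rainbow A].

Definition has_monochromatic (t : nat) : bool :=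
  [exists A : {set 'I_n}, (#|A| == t) && monochromatic A].

End Copies.

Definition gallai_ramsey (k s t n : nat) : bool :=
  [forall c : coloring n k, has_rainbow c s || has_monochromatic c t].

(* Multicolor Ramsey theorem, in a form where P i x y reads "the edge xy has
   color i". It is only needed to show that the minimum defining gr exists. *)
Lemma ramsey (k : nat) (f : {ffun 'I_k -> nat}) :
  exists N : nat, forall (T : finType) (P : 'I_k -> rel T) (S : {set T}),
    (forall i, symmetric (P i)) ->
    (forall x y, x != y -> exists i, P i x y) ->
    N <= #|S| ->
    exists i, exists A : {set T},
      [/\ A \subset S, #|A| = f i & {in A &, forall x y, x != y -> P i x y}].
Proof.
have [m] := ubnP (\sum_i f i); elim: m f => // m IHm f lt_f_m.
have [i fi0 | f_gt0] := pickP (fun i => f i == 0).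
  exists 0 => T P S _ _ _; exists i, set0; split; first exact: sub0set.
    by rewrite cards0 (eqP fi0).
  by move=> x y; rewrite inE.
pose g i : {ffun 'I_k -> nat} := [ffun j => f j - (j == i)].
have lt_g i : \sum_j g i j < m.
  rewrite -ltnS; apply: leq_trans lt_f_m; rewrite ltnS.
  rewrite (bigD1 i) //= [X in _ < X](bigD1 i) //= ffunE eqxx.
  rewrite (eq_bigr f) => [|j /negPf ne_ji]; last by rewrite ffunE ne_ji subn0.
  by rewrite ltn_add2r subn1 prednK // lt0n f_gt0.
have /fin_all_exists[N NP] := fun i => IHm (g i) (lt_g i).
exists (\sum_i N i).+2 => T P S Psym Ptot leNS.
have /card_gt0P[v Sv] : 0 < #|S| by apply: leq_trans leNS.
pose C i := [set w in S :\ v | P i v w].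
have [i leNC | smallC] := pickP (fun i => N i <= #|C i|); last first.
  have sub : S :\ v \subset \bigcup_i C i.
    apply/subsetP=> w Sw; have [ne_wv _] := setD1P Sw.
    have [|i Pi] := Ptot v w; first by rewrite eq_sym.
    by apply/bigcupP; exists i; rewrite // inE Sw.
  have leUC : #|\bigcup_i C i| <= \sum_i #|C i|.
    elim/big_rec2: _ => [|i a B _ leBa]; first by rewrite cards0.
    by apply: leq_trans (leq_card_setU _ _) _; rewrite leq_add2l.
  have := leq_trans (subset_leq_card sub) leUC.
  move: leNS; rewrite (cardsD1 v) Sv ltnS => leNS leSC.
  have := leq_trans leNS leSC; rewrite ltnNge leq_sum // => i _.
  by rewrite ltnW // ltnNge smallC.
have [j [A [sAC cA PA]]] := NP i T P (C i) Psym Ptot leNC.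
have sCS : C i \subset S by apply/subsetP=> w; rewrite !inE => /andP[/andP[]].
have [eq_ji | ne_ji] := eqVneq j i; last first.
  exists j, A; split=> //; first exact: subset_trans sCS.
  by rewrite cA ffunE (negPf ne_ji) subn0.
move: cA PA; rewrite {j}eq_ji => cA PA.
have CA w : w \in A -> (w != v) && P i v w.
  by move=> /(subsetP sAC); rewrite !inE => /andP[/andP[-> _] ->].
exists i, (v |: A); split.
- by rewrite subUset sub1set Sv (subset_trans sAC).
- have -> : #|v |: A| = #|A|.+1.
    by rewrite cardsU1; case: (boolP (v \in A)) => // /CA; rewrite eqxx.
  by rewrite cA ffunE eqxx subn1 prednK // lt0n f_gt0.
move=> x y /setU1P[-> | Ax] /setU1P[-> | Ay] ne_xy.
- by rewrite eqxx in ne_xy.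
- by have /andP[] := CA y Ay.
- by rewrite Psym; have /andP[] := CA x Ax.
exact: PA.
Qed.

Lemma gr_exists (k s t : nat) : exists n, gallai_ramsey k s t n.
Proof.
have [n ramsey_n] := ramsey [ffun _ : 'I_k => t].
exists n; apply/forallP=> c; apply/orP; right.
pose P i (x y : 'I_n) :=
  [exists e : edge 'I_n, (val e == [set x; y]) && (c e == i)].
have [||| i [A [_ cA PA]]] := ramsey_n _ P setT.
- by move=> i x y; rewrite /P setUC.
- move=> x y ne_xy; have xyP : #|[set x; y]| == 2 by rewrite cards2 ne_xy.
  pose e : edge 'I_n := Sub [set x; y] xyP.
  by exists (c e); apply/existsP; exists e; rewrite SubK !eqxx.
- by rewrite cardsT card_ord.
apply/existsP; exists A; rewrite cA ffunE eqxx /=.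
have colA (e : edge 'I_n) : val e \subset A -> c e = i.
  have /cards2P[x [y [ne_xy def_e]]] := valP e.
  rewrite def_e subUset !sub1set => /andP[Ax Ay].
  have /existsP[f /andP[/eqP def_f /eqP <-]] := PA x y Ax Ay ne_xy.
  by congr (c _); apply: val_inj; rewrite def_f.
by apply/'forall_forallP=> e f; apply/implyP=> /andP[/colA-> /colA->].
Qed.

Definition gr (k s t : nat) : nat := ex_minn (gr_exists k s t).

(* Main.v *)
(* Colour the edges independently at random, colour i having probability p i.
   On a given s-set, each of the 'C(s, 2)-subsets X of the colours is the image
   of 'C(s, 2)! injective colourings, each of probability \prod_(i in X) p i; on
   a given t-set each of the constant colourings i has probability
   p i ^+ 'C(t, 2). By the union bound some colouring of K_n has neither a
   rainbow K_s nor a monochromatic K_t; and a colouring of K_n without them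
   restricts to such a colouring of K_m for every m <= n. *)
Require Import Defs.
From mathcomp Require Import all_boot all_order all_algebra.

Set Implicit Arguments.
Unset Strict Implicit.
Unset Printing Implicit Defensive.

Import Order.TTheory GRing.Theory Num.Theory.
Local Open Scope ring_scope.

Section ProductMeasure.
Variables (R : realFieldType) (K : finType) (p : K -> R).
Hypotheses (p_ge0 : forall i, 0 <= p i) (sum_p : \sum_i p i = 1).

Definition weight (I : finType) (c : {ffun I -> K}) : R := \prod_i p (c i).

Lemma weight_ge0 (I : finType) (c : {ffun I -> K}) : 0 <= weight c.
Proof. exact: prodr_ge0. Qed.

Lemma sum_weight (I : finType) : \sum_(c : {ffun I -> K}) weight c = 1.
Proof. by rewrite -(bigA_distr_bigA (fun _ : I => p)) big1. Qed.

(** The condition on [c] constrains each coordinate separately, so the sum factors over [I]. The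
    factor at [h x] is [p (d x)]; off the image of [h] every colour is allowed and the factor is the
    total mass 1. *)
Lemma sum_weight_fiber (D I : finType) (h : D -> I) (d : {ffun D -> K}) :
  injective h ->
  \sum_(c : {ffun I -> K} | [ffun x => c (h x)] == d) weight c = weight d.
Proof.
move=> h_inj; pose Q i : pred K := fun j => [forall x, (h x == i) ==> (j == d x)].
rewrite (eq_bigl (fun c => c \in family Q)); last first.
  move=> c; apply/eqP/familyP => [cd i | cQ].
    by apply/forallP=> x; apply/implyP=> /eqP <-; rewrite -cd ffunE.
  apply/ffunP=> x; rewrite ffunE.
  by have /forallP/(_ x) := cQ (h x); rewrite eqxx => /eqP.
rewrite -(bigA_distr_big_dep Q (fun _ : I => p)).
rewrite (bigID (fun i => i \in h @: D)) /= [X in _ * X]big1 ?mulr1.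
  rewrite big_imset /=; last by move=> x y _ _ /h_inj.
  apply: eq_bigr => x _; rewrite (big_pred1 (d x)) // => j.
  apply/forallP/eqP => [/(_ x) | -> y]; first by rewrite eqxx => /eqP.
  by apply/implyP=> /eqP /h_inj ->.
move=> i iNh; rewrite -[RHS]sum_p; apply: eq_bigl => j.
apply/forallP=> x; apply/implyP=> /eqP hx_i.
by rewrite -hx_i imset_f in iNh.
Qed.

(** An event that only looks at the coordinates in the image of [h] can be measured on [D] alone. It
    is used with [h] the inclusion of the edges inside a vertex set [A] into all edges. *)
Lemma sum_weight_marginal (D I : finType) (h : D -> I)
    (P : pred {ffun D -> K}) :
  injective h ->
  \sum_(c : {ffun I -> K} | P [ffun x => c (h x)]) weight c
    = \sum_(d | P d) weight d.
Proof.
move=> h_inj.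
rewrite (partition_big (fun c : {ffun I -> K} => [ffun x => c (h x)]) P) //=.
apply: eq_bigr => d Pd; rewrite -(sum_weight_fiber d h_inj).
by apply: eq_bigl => c; case: eqP => [->|]; rewrite ?Pd ?andbF.
Qed.

Lemma sum_weight_injective (D : finType) :
  \sum_(d : {ffun D -> K} | injectiveb d) weight d
    = #|D|`!%:R * \sum_(X : {set K} | #|X| == #|D|) \prod_(i in X) p i.
Proof.
rewrite (partition_big (fun d : {ffun D -> K} => d @: D)
  (fun X : {set K} => #|X| == #|D|)) /=; last first.
  by move=> d /injectiveP d_inj; rewrite card_imset.
rewrite mulr_sumr; apply: eq_bigr => X /eqP cardX.
rewrite (eq_bigr (fun _ => \prod_(i in X) p i)); last first.
  move=> d /andP[/injectiveP d_inj /eqP <-].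
  by rewrite big_imset // => x y _ _ /d_inj.
rewrite sumr_const mulr_natl; congr (_ *+ _).
(* As [X] and [D] have the same size, the maps onto [X] that are injective are exactly the
   injections into [X], counted by a falling factorial. *)
rewrite -ffactnn -{1}cardX -card_inj_ffuns_on -cardsE; congr #|pred_of_set _|.
apply/setP=> d; rewrite !inE unfold_in.
apply/andP/andP=> [[d_inj /eqP dX] | [/forallP dX d_inj]]; split=> //.
  by apply/forallP=> x; rewrite -dX imset_f.
rewrite eqEcard cardX card_imset ?leqnn; last exact/injectiveP.
by rewrite andbT; apply/subsetP=> _ /imsetP[x _ ->].
Qed.

(** For empty [D] the single empty function is counted once on the left and once per colour on the
    right, whence an inequality; [k0] guarantees that there is a colour. *)
Lemma sum_weight_constant (D : finType) (k0 : K) :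
  \sum_(d : {ffun D -> K} | [forall x, forall y, d x == d y]) weight d
    <= \sum_i p i ^+ #|D|.
Proof.
pose const i : {ffun D -> K} := [ffun => i].
have -> : \sum_i p i ^+ #|D| = \sum_i weight (const i).
  apply: eq_bigr => i _; rewrite /weight -prodr_const.
  by apply: eq_bigr => x _; rewrite ffunE.
rewrite (partition_big const predT) //=.
rewrite big_mkcond; apply: ler_sum => d _.
case: ifP => [/'forall_forallP d_const | _]; last first.
  by apply: sumr_ge0 => i _; apply: weight_ge0.
have [i /eqP def_d] : exists i, const i == d.
  have [x _ | D0] := pickP D.
    by exists (d x); apply/eqP/ffunP=> y; rewrite ffunE (eqP (d_const y x)).
  by exists k0; apply/eqP/ffunP=> y; have := D0 y.
rewrite (bigD1 i) ?def_d //= lerDl.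
by apply: sumr_ge0 => j _; apply: weight_ge0.
Qed.

End ProductMeasure.

Lemma card_edges_in (T : finType) (A : {set T}) :
  #|{: {e : edge T | val e \subset A}}| = 'C(#|A|, 2).
Proof.
rewrite card_sig -cards_draws -(card_imset _ val_inj).
apply: eq_card => B; rewrite inE.
apply/imsetP/andP=> [[e eA ->] | [BA B2]]; first by rewrite (valP e).
by exists (Sub B B2); rewrite ?inE SubK.
Qed.

Section Restriction.
Variables (n k : nat) (A : {set 'I_n}).
Let edge_in := {e : edge 'I_n | val e \subset A}.

(** This and [monochromaticE] show that the event depends only on the colours inside [A], in the
    shape that [sum_weight_marginal] expects. *)
Lemma rainbowE (c : coloring n k) :
  rainbow c A = injectiveb [ffun e : edge_in => c (val e)].
Proof.
apply/'forall_forallP/injectiveP => [cA e f | c_inj e f].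
  rewrite !ffunE => ce; apply/val_inj/eqP.
  by apply: (implyP (cA _ _)); rewrite (valP e) (valP f) ce /=.
apply/implyP=> /and3P[eA fA /eqP ce]; apply/eqP.
have /(congr1 val) // : Sub e eA = Sub f fA :> edge_in.
by apply: c_inj; rewrite !ffunE !SubK.
Qed.

Lemma monochromaticE (c : coloring n k) :
  monochromatic c A
    = [forall e, forall f, [ffun e : edge_in => c (val e)] e
                        == [ffun e : edge_in => c (val e)] f].
Proof.
apply/'forall_forallP/'forall_forallP => cA e f.
  by rewrite !ffunE; apply: (implyP (cA _ _)); rewrite (valP e) (valP f).
apply/implyP=> /andP[eA fA].
by have := cA (Sub e eA) (Sub f fA); rewrite !ffunE !SubK.
Qed.

End Restriction.

Lemma gallai_ramsey_leq (k s t m n : nat) :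
  (m <= n)%N -> gallai_ramsey k s t m -> gallai_ramsey k s t n.
Proof.
move=> le_mn /forallP mP; apply/forallP=> c.
pose w := widen_ord le_mn.
have w_inj : injective w by move=> x y /(congr1 val) /= /val_inj.
have wE (e : edge 'I_m) : #|w @: val e| == 2%N by rewrite card_imset // (valP e).
pose we (e : edge 'I_m) : edge 'I_n := Sub (w @: val e) (wE e).
(* An edge inside [w @: A] lies in the image of the injection [w], so its preimage again has two
   vertices. *)
have lift_edge (A : {set 'I_m}) (e : edge 'I_n) :
    val e \subset w @: A -> exists2 f : edge 'I_m, val f \subset A & we f = e.
  move=> eA; have fE : w @: (w @^-1: val e) = val e.
    apply/setP=> y; apply/imsetP/idP => [[x] | ey]; first by rewrite inE => ? ->.
    by have /imsetP[x _ yE] := subsetP eA y ey; exists x; rewrite // inE -yE.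
  have f2 : #|w @^-1: val e| == 2%N by rewrite -(card_imset _ w_inj) fE (valP e).
  exists (Sub (w @^-1: val e) f2); last by apply: val_inj; rewrite !SubK.
  rewrite SubK; apply/subsetP=> x; rewrite inE => /(subsetP eA).
  by rewrite mem_imset.
have /orP[] := mP [ffun e => c (we e)] => /existsP[A /andP[cardA cA]];
  apply/orP; [left | right]; apply/existsP; exists (w @: A);
  rewrite card_imset // cardA /=; apply/'forall_forallP=> e f; apply/implyP.
- case/and3P=> /lift_edge[e' e'A <-] /lift_edge[f' f'A <-] ce.
  apply/eqP; congr we; apply/eqP.
  by have /'forall_forallP/(_ e' f')/implyP := cA; rewrite !ffunE e'A f'A; apply.
case/andP=> /lift_edge[e' e'A <-] /lift_edge[f' f'A <-].
by have /'forall_forallP/(_ e' f')/implyP := cA; rewrite !ffunE e'A f'A; apply.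
Qed.

(** After exchanging the sums, each [x] of the union is counted at least once on the right. *)
Lemma sum_union_bound (R : realFieldType) (T I : finType) (w : T -> R)
    (Q : pred I) (P : I -> pred T) :
  (forall x, 0 <= w x) ->
  \sum_(x | [exists i, Q i && P i x]) w x <= \sum_(i | Q i) \sum_(x | P i x) w x.
Proof.
move=> w_ge0; rewrite [leRHS](exchange_big_dep predT) //= big_mkcond.
apply: ler_sum => x _; case: ifP => [/existsP[i QP] | _].
  by rewrite (bigD1 i) //= lerDl sumr_ge0.
exact: sumr_ge0.
Qed.

Theorem theorem3p2 (R : realFieldType) (n s t k : nat)
    (hn : (0 < n)%N) (hs : (0 < s)%N) (ht : (0 < t)%N) (hk : (0 < k)%N)
    (hks : ('C(s, 2) <= k)%N)
    (p : 'I_k -> R) (hp : forall i, 0 <= p i <= 1) (hp1 : \sum_i p i = 1)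
    (hlt : 'C(n, s)%:R * ((s * (s - 1)) %/ 2)`!%:R
             * (\sum_(X : {set 'I_k} | #|X| == 'C(s, 2)) \prod_(i in X) p i)
           + 'C(n, t)%:R * (\sum_i p i ^+ 'C(t, 2)) < 1) :
  (n < gr k s t)%N.
Proof.
have p_ge0 i : 0 <= p i by case/andP: (hp i).
(* By contraposition: if [gr k s t <= n], every colouring of $K_n$ contains one of the two copies,
   and the left side of [hlt] is at least the total weight 1. *)
rewrite ltnNge; apply: contraTN hlt => le_gr_n; rewrite -leNgt.
have {le_gr_n} /forallP c_bad : gallai_ramsey k s t n.
  by apply: gallai_ramsey_leq le_gr_n _; rewrite /gr; case: ex_minnP.
pose w : coloring n k -> R := weight p (I := _).
have w_ge0 : forall c, 0 <= w c by apply: weight_ge0.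
have sum_draws r (x : R) :
    'C(n, r)%:R * x = \sum_(A : {set 'I_n} | #|A| == r) x.
  by rewrite sumr_const -cardsE card_draws card_ord mulr_natl.
have rainbow_le : \sum_(c | has_rainbow c s) w c
    <= 'C(n, s)%:R * ((s * (s - 1)) %/ 2)`!%:R
       * \sum_(X : {set 'I_k} | #|X| == 'C(s, 2)) \prod_(i in X) p i.
  apply: le_trans (sum_union_bound _ (fun A c => rainbow c A) w_ge0) _.
  rewrite divn2 subn1 -bin2 -mulrA sum_draws; apply: ler_sum => A /eqP cardA.
  rewrite (eq_bigl _ _ (fun c => rainbowE A c)).
  rewrite (sum_weight_marginal hp1 (fun d => injectiveb d) val_inj).
  by rewrite sum_weight_injective card_edges_in cardA.
have mono_le : \sum_(c | has_monochromatic c t) w c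
    <= 'C(n, t)%:R * \sum_i p i ^+ 'C(t, 2).
  apply: le_trans
    (sum_union_bound _ (fun A c => monochromatic c A) w_ge0) _.
  rewrite sum_draws; apply: ler_sum => A /eqP cardA.
  rewrite (eq_bigl _ _ (fun c => monochromaticE A c)).
  rewrite (sum_weight_marginal hp1
    (fun d => [forall e, forall f, d e == d f]) val_inj).
  (* The colour [Ordinal hk] serves the case [t = 1], where [A] contains no edge. *)
  apply: le_trans (sum_weight_constant p_ge0 _ (Ordinal hk)) _.
  by rewrite card_edges_in cardA.
rewrite -[leLHS](sum_weight hp1 (edge 'I_n)).
apply: le_trans (lerD rainbow_le mono_le).
(* Compared colouring by colouring: by [c_bad], each [w c] occurs in at least one of the two
   sums. *)
rewrite [X in _ <= X + _]big_mkcond [X in _ <= _ + X]big_mkcond -big_split /=.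
apply: ler_sum => c _; have := c_bad c; rewrite -/(w c).
by case: (has_rainbow c s); case: (has_monochromatic c t) => //= _;
  rewrite ?addr0 ?add0r ?lerDl.
Qed.
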